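(* Let $\mathcal{Q}$ be a small quantaloid. If every identity arrow of $\mathcal{Q}$ is finitely join-irreducible, then the categorical closure associated to any $\mathcal{Q}$-category $\mathbb{C}$ is topological. If $\mathcal{Q}$ is integral then the converse holds too: if the categorical closure on every $\mathcal{Q}$-category is topological, then every identity arrow of $\mathcal{Q}$ is finitely join-irreducible.
   Context: A quantaloid $\mathcal{Q}$ is a category in which every hom-set is a complete lattice and composition distributes over arbitrary suprema in both variables. It is integral if for every object $A$ the identity $1_A$ is the top element of $\mathcal{Q}(A,A)$. An identity arrow $1_X$ is finitely join-irreducible if, for every $n\in\mathbb{N}$ (including $n=0$), $1_X\le f_1\vee\dots\vee f_n$ in $\mathcal{Q}(X,X)$ implies $1_X\le f_i$ for some $i$; in other words, $1_X$ is not the bottom element of $\mathcal{Q}(X,X)$, and $1_X\le f\vee g$ implies $1_X\le f$ or $1_X\le g$. A $\mathcal{Q}$-category $\mathbb{C}$ consists of a set $\mathbb{C}_0$, a type map $t\colon\mathbb{C}_0\to\mathcal{Q}_0$ (the objects of $\mathcal{Q}$) and homs $\mathbb{C}(x,y)\in\mathcal{Q}(ty,tx)$ with $\mathbb{C}(x,y)\circ\mathbb{C}(y,z)\le\mathbb{C}(x,z)$ and $1_{tx}\le\mathbb{C}(x,x)$. For $S\subseteq T\subseteq\mathbb{C}_0$, $S$ is fully dense in $T$ if $\mathbb{C}(y,x)=\bigvee_{s\in S}\mathbb{C}(y,s)\circ\mathbb{C}(s,x)$ for all $x,y\in T$. The categorical closure $\overline{S}$ of $S$ in $\mathbb{C}$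 is the largest subset of $\mathbb{C}_0$ in which $S$ is fully dense; equivalently, $\overline{S}=\{x\in\mathbb{C}_0\mid 1_{tx}\le\bigvee_{s\in S}\mathbb{C}(x,s)\circ\mathbb{C}(s,x)\}$. A closure is topological if $\overline{\emptyset}=\emptyset$ (grounded) and $\overline{S\cup T}=\overline{S}\cup\overline{T}$ for all subsets $S,T$ (additive). *)

(* Defs.v *)
From mathcomp Require Import all_boot all_order.
From mathcomp Require Import boolp classical_sets.

Set Implicit Arguments.
Unset Strict Implicit.
Unset Printing Implicit Defensive.

Import Order.TTheory.

Local Open Scope classical_set_scope.
Local Open Scope order_scope.

(* [qcomp g f] is "g after f".  The display [d] is only MathComp's tag for the
   order notation on the hom-posets and carries no mathematical content. *)
Record quantaloid (d : Order.disp_t) := Quantaloid {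
  qobj : Type;
  qhom : qobj -> qobj -> porderType d;
  qid : forall A, qhom A A;
  qcomp : forall A B C, qhom B C -> qhom A B -> qhom A C;
  qcompA : forall A B C D (h : qhom C D) (g : qhom B C) (f : qhom A B),
    qcomp h (qcomp g f) = qcomp (qcomp h g) f;
  qcomp1f : forall A B (f : qhom A B), qcomp (qid B) f = f;
  qcompf1 : forall A B (f : qhom A B), qcomp f (qid A) = f;
  qsup : forall A B, set (qhom A B) -> qhom A B;
  qsupP : forall A B (F : set (qhom A B)), supremums F (qsup F);
  qcomp_supl : forall A B C (G : set (qhom B C)) (f : qhom A B),
    qcomp (qsup G) f = qsup [set qcomp g f | g in G];
  qcomp_supr : forall A B C (g : qhom B C) (F : set (qhom A B)),
    qcomp g (qsup F) = qsup [set qcomp g f | f in F]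
}.

Arguments qid {d q} A.

Definition integral_quantaloid d (Q : quantaloid d) : Prop :=
  forall (A : qobj Q) (f : qhom A A), f <= qid A.

Definition fin_join_irreducible_id d (Q : quantaloid d) (X : qobj Q) : Prop :=
  forall (n : nat) (f : 'I_n -> qhom X X),
    qid X <= qsup (range f) -> exists i : 'I_n, qid X <= f i.

Record qcat d (Q : quantaloid d) := QCat {
  cobj : Type;
  ctype : cobj -> qobj Q;
  chom : forall x y : cobj, qhom (ctype y) (ctype x);
  chom_comp : forall x y z, qcomp (chom x y) (chom y z) <= chom x z;
  chom_id : forall x, qid (ctype x) <= chom x x
}.

Section Closure.
Context {d : Order.disp_t} {Q : quantaloid d} (C : qcat Q).
Implicit Types S T : set (cobj C).

Definition fully_dense S T : Prop :=
  S `<=` T /\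
  forall x y, T x -> T y ->
    chom y x = qsup [set qcomp (chom y s) (chom s x) | s in S].

(* The union of all T in which S is fully dense; [fully_dense_cat_closure]
   shows that S is fully dense in it, so it is the largest such T. *)
Definition cat_closure S : set (cobj C) :=
  [set x | exists2 T, fully_dense S T & T x].

Lemma qsup_ub (A B : qobj Q) (F : set (qhom A B)) f : F f -> f <= qsup F.
Proof. by case: (qsupP F) => ub _ Ff; apply: ub. Qed.

Lemma qsup_lub (A B : qobj Q) (F : set (qhom A B)) g :
  (forall f, F f -> f <= g) -> qsup F <= g.
Proof. by case: (qsupP F) => _ lub Fg; apply: lub. Qed.

Lemma qsup2 (A B : qobj Q) (f g : qhom A B) : f <= g -> qsup [set f; g] = g.
Proof.
move=> fg; apply/le_anti/andP; split.
  by apply: qsup_lub => h [->|->].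
by apply: qsup_ub; right.
Qed.

Lemma qcomp_lel (A B D : qobj Q) (g g' : qhom B D) (f : qhom A B) :
  g <= g' -> qcomp g f <= qcomp g' f.
Proof.
move=> gg'; rewrite -(qsup2 gg') qcomp_supl.
by apply: qsup_ub; exists g => //; left.
Qed.

Lemma qcomp_ler (A B D : qobj Q) (g : qhom B D) (f f' : qhom A B) :
  f <= f' -> qcomp g f <= qcomp g f'.
Proof.
move=> ff'; rewrite -(qsup2 ff') qcomp_supr.
by apply: qsup_ub; exists f => //; left.
Qed.

Let dense_pts S : set (cobj C) :=
  [set x | qid (ctype x) <= qsup [set qcomp (chom x s) (chom s x) | s in S]].

Let fully_dense_pts S : fully_dense S (dense_pts S).
Proof.
split=> [s Ss|x y Tx _].
  apply: le_trans (chom_id s) _.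
  rewrite -{1}(qcompf1 (chom s s)).
  apply: le_trans (qcomp_ler _ (chom_id s)) _.
  by apply: qsup_ub; exists s.
apply/le_anti/andP; split; last first.
  by apply: qsup_lub => _ [s _ <-]; apply: chom_comp.
rewrite -{1}(qcompf1 (chom y x)).
apply: le_trans (qcomp_ler _ Tx) _.
rewrite qcomp_supr; apply: qsup_lub => _ [_ [s Ss <-] <-].
rewrite qcompA; apply: le_trans (qcomp_lel _ (chom_comp y x s)) _.
by apply: qsup_ub; exists s.
Qed.

Lemma cat_closureE S : cat_closure S =
  [set x | qid (ctype x) <= qsup [set qcomp (chom x s) (chom s x) | s in S]].
Proof.
apply/seteqP; split=> x /=.
  by case=> T [_ dST] Tx; rewrite -dST //; apply: chom_id.
by move=> Tx; exists (dense_pts S) => //; apply: fully_dense_pts.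
Qed.

Lemma fully_dense_cat_closure S : fully_dense S (cat_closure S).
Proof. by rewrite cat_closureE; apply: fully_dense_pts. Qed.

End Closure.

Definition topological_closure (T : Type) (cl : set T -> set T) : Prop :=
  cl set0 = set0 /\ forall A B : set T, cl (A `|` B) = cl A `|` cl B.

(* Main.v *)
Require Import Defs.
From mathcomp Require Import all_boot all_order.
From mathcomp Require Import boolp classical_sets.

(** Call the join of the endo-arrows [qcomp (chom x s) (chom s x)], [s] in [S],
    the trace of [S] at [x]: the point [x] lies in the closure of [S] when the
    identity is below that trace, and the trace of a union is the join of the
    traces.  Finite join-irreducibility therefore forces a point in the closure
    of a finite union to lie in the closure of one of the pieces.
    The union of no sets gives groundedness and the union of two gives
    additivity ([cat_closure_bigcup]).

    Conversely, a finite family of endo-arrows [f i] of [X] over an integral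
    quantaloid is realised as the traces of points: [star_cat] has one object
    per index and an extra object [None], and the trace of the singleton of
    [Some i] at [None] is exactly [f i].  If [f] covers the identity, then
    [None] is in the closure of the set of all [Some i].  A topological closure
    commutes with finite unions ([topological_closure_bigcup]), so [None] is in
    the closure of a single [Some i], which means that [f i] is above the
    identity. *)

Set Implicit Arguments.
Unset Strict Implicit.
Unset Printing Implicit Defensive.

Import Order.TTheory.

Local Open Scope classical_set_scope.
Local Open Scope order_scope.

Section ClosureOfJoinIrreducible.
Context {d : Order.disp_t} {Q : quantaloid d} (C : qcat Q).

Lemma cat_closureS (S T : set (cobj C)) :
  S `<=` T -> cat_closure S `<=` cat_closure T.
Proof.
move=> ST x; rewrite !cat_closureE /= => /le_trans; apply.
by apply: qsup_lub => _ [s /ST Ts <-]; apply: qsup_ub; exists s.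
Qed.

(** Irreducibility is applied to the traces of the [F i] at the given point. *)
Lemma cat_closure_bigcup (n : nat) (F : 'I_n -> set (cobj C)) :
  (forall X : qobj Q, fin_join_irreducible_id X) ->
  cat_closure (\bigcup_i F i) `<=` \bigcup_i cat_closure (F i).
Proof.
move=> irr x; rewrite cat_closureE /= => clx.
pose trace i := qsup [set qcomp (chom x s) (chom s x) | s in F i].
have [|i ltrace] := irr (ctype x) n trace; last first.
  by exists i => //; rewrite cat_closureE.
apply: le_trans clx _; apply: qsup_lub => _ [s [i _ Fs] <-].
apply: (@le_trans _ _ (trace i)); first by apply: qsup_ub; exists s.
by apply: qsup_ub; exists i.
Qed.

Lemma join_irreducible_topological :
  (forall X : qobj Q, fin_join_irreducible_id X) ->
  topological_closure (@cat_closure d Q C).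
Proof.
move=> irr; split.
  rewrite -subset0 => x clx.
  have [|[] //] := @cat_closure_bigcup 0 (fun=> set0) irr x.
  by apply: cat_closureS clx.
move=> A B; apply/seteqP; split=> x; last first.
  by case; apply: cat_closureS => y; [left|right].
pose F (i : 'I_2) := if i == ord0 then A else B.
move=> clx; have [|i _] := @cat_closure_bigcup 2 F irr x.
  apply: cat_closureS clx => y [Ay|By]; first by exists ord0.
  by exists ord_max.
by rewrite /F; case: ifP => _; [left|right].
Qed.

End ClosureOfJoinIrreducible.

Lemma topological_closure_bigcup (T : Type) (cl : set T -> set T) (I : finType)
    (F : I -> set T) :
  topological_closure cl -> cl (\bigcup_i F i) = \bigcup_i cl (F i).
Proof.
case=> cl0 clU.
have setT_enum : [set: I] = [set` index_enum I].
  by apply/seteqP; split=> i //= _; rewrite mem_index_enum.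
by rewrite setT_enum !bigcup_seq; apply: big_morph.
Qed.

Section StarCategory.
Context {d : Order.disp_t} {Q : quantaloid d}.
Hypothesis Qint : integral_quantaloid Q.
Context (X : qobj Q) (I : eqType) (f : I -> qhom X X).

(** Off the diagonal the value ignores the first argument, so that an arrow of
    the triangle inequality reappears on both sides; integrality then gives the
    inequality, as composing with an endo-arrow on the left can only
    decrease. *)
Definition star_hom (y z : option I) : qhom X X :=
  if y == z then qid X else oapp f (qid X) z.

Lemma star_hom_comp y w z :
  qcomp (star_hom y w) (star_hom w z) <= star_hom y z.
Proof.
have [<-|wz] := eqVneq w z.
  by rewrite {2}/star_hom eqxx qcompf1.
have [<-|yz] := eqVneq y z.
  by rewrite {3}/star_hom eqxx; apply: Qint.
rewrite /star_hom (negPf wz) (negPf yz) -[leRHS]qcomp1f.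
by apply/qcomp_lel/Qint.
Qed.

Lemma star_hom_id y : qid X <= star_hom y y.
Proof. by rewrite /star_hom eqxx. Qed.

Definition star_cat : qcat Q :=
  @QCat d Q (option I) (fun=> X) star_hom star_hom_comp star_hom_id.

Lemma star_trace i : qcomp (star_hom None (Some i)) (star_hom (Some i) None) = f i.
Proof. exact: qcompf1. Qed.

Lemma star_closure1 i :
  @cat_closure d Q star_cat [set Some i] None -> qid X <= f i.
Proof.
rewrite cat_closureE /= => /le_trans; apply.
by apply: qsup_lub => _ [_ -> <-]; rewrite star_trace.
Qed.

Lemma star_closure_points : qid X <= qsup (range f) ->
  @cat_closure d Q star_cat (\bigcup_i [set Some i]) None.
Proof.
rewrite cat_closureE /= => /le_trans; apply.
apply: qsup_lub => _ [i _ <-]; apply: qsup_ub.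
by exists (Some i); [exists i|exact: star_trace].
Qed.

End StarCategory.

Lemma topological_join_irreducible (d : Order.disp_t) (Q : quantaloid d) :
  integral_quantaloid Q ->
  (forall C : qcat Q, topological_closure (@cat_closure d Q C)) ->
  forall X : qobj Q, fin_join_irreducible_id X.
Proof.
move=> Qint top X n f /(star_closure_points Qint).
rewrite (topological_closure_bigcup _ (top _)) => -[i _].
by move=> /star_closure1; exists i.
Qed.

Theorem proposition4p3p3 (d : Order.disp_t) (Q : quantaloid d) :
  ((forall X : qobj Q, fin_join_irreducible_id X) ->
   forall C : qcat Q, topological_closure (@cat_closure d Q C))
  /\
  (integral_quantaloid Q ->
   (forall C : qcat Q, topological_closure (@cat_closure d Q C)) ->
   forall X : qobj Q, fin_join_irreducible_id X).
Proof.
split; last exact: topological_join_irreducible.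
by move=> irr C; apply: join_irreducible_topological.
Qed.
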